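(* Let $\Sigma$ be a finite alphabet. The class of functions $\Sigma^*\to[0,1]$ induced by MO-1gQFA over $\Sigma$ is closed under the following operations: (i) If $f$ is a function induced by an MO-1gQFA, then $1-f$ is also induced by an MO-1gQFA. (ii) If $f_1,f_2,\dots,f_k$ are functions induced by MO-1gQFA, then $\sum_{i=1}^k c_i f_i$ is also induced by an MO-1gQFA for any real constants $c_i>0$ such that $\sum_{i=1}^k c_i=1$. (iii) If $f_1,f_2,\dots,f_k$ are functions induced by MO-1gQFA, then the pointwise product $f_1f_2\cdots f_k$, defined by $(f_1f_2\cdots f_k)(w)=f_1(w)f_2(w)\cdots f_k(w)$, is also induced by an MO-1gQFA.
   Context: For a finite-dimensional complex Hilbert space $\mathcal{H}$, let $L(\mathcal{H})$ be the set of linear operators on $\mathcal{H}$. A density operator on $\mathcal{H}$ is a positive semidefinite operator of trace $1$. A trace-preserving quantum operation acting on $\mathcal{H}$ is a map $\mathcal{E}:L(\mathcal{H})\to L(\mathcal{H})$ of the form $\mathcal{E}(\rho)=\sum_k E_k\rho E_k^\dagger$ (finite sum, $E_k\in L(\mathcal{H})$) with $\sum_k E_k^\dagger E_k=I$. A measure-once one-way general quantum finite automaton (MO-1gQFA) is a tuple $\mathcal{M}=\{\mathcal{H},\Sigma,\rho_0,\{\mathcal{E}_\sigma\}_{\sigma\in\Sigma},P_{acc}\}$ where $\mathcal{H}$ is a finite-dimensional Hilbert space, $\Sigma$ is a finite input alphabet, $\rho_0$ is a density operator on $\mathcal{H}$ (the initial state), each $\mathcal{E}_\sigma$ is a trace-preserving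 quantum operation acting on $\mathcal{H}$, and $P_{acc}$ is an orthogonal projector on a subspace of $\mathcal{H}$ (the accepting subspace). It induces the function $f_{\mathcal{M}}:\Sigma^*\to[0,1]$, $$f_{\mathcal{M}}(\sigma_1\sigma_2\cdots\sigma_n)=\mathrm{Tr}\big(P_{acc}\,\mathcal{E}_{\sigma_n}\circ\cdots\circ\mathcal{E}_{\sigma_2}\circ\mathcal{E}_{\sigma_1}(\rho_0)\big),$$ (for the empty word, $\mathrm{Tr}(P_{acc}\rho_0)$), the probability that $\mathcal{M}$ accepts the word. *)

(* Defs.v *)
From HB Require Import structures.
From mathcomp Require Import all_boot all_order all_algebra.
From mathcomp Require Import spectral complex.
From mathcomp Require Import reals.

Set Implicit Arguments.
Unset Strict Implicit.
Unset Printing Implicit Defensive.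

Import Order.TTheory GRing.Theory Num.Theory.

Local Open Scope ring_scope.
Local Open Scope complex_scope.
Local Open Scope sesquilinear_scope.

(* A finite-dimensional complex Hilbert space is taken to be C^n with its
   standard inner product; an operator is its n x n matrix acting on column
   vectors, and A^t* is the conjugate transpose. *)

Section QuantumOperations.
Variables (R : realType) (n : nat).
Implicit Types (A P rho : 'M[R[i]]_n) (Op : 'M[R[i]]_n -> 'M[R[i]]_n).

(* In R[i], 0 <= z means that z is real and nonnegative. *)
Definition possemidef A :=
  forall v : 'cV[R[i]]_n, 0 <= (v^t* *m A *m v) 0 0.

Definition density rho := possemidef rho /\ \tr rho = 1.

Definition tp_quantum_operation Op :=
  exists (m : nat) (K : 'I_m -> 'M[R[i]]_n),
    \sum_(k < m) (K k)^t* *m K k = 1%:M /\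
    forall rho, Op rho = \sum_(k < m) K k *m rho *m (K k)^t*.

Definition orthogonal_projector P := P *m P = P /\ P^t* = P.

End QuantumOperations.

Record mo1gqfa (R : realType) (Sigma : finType) := MO1gQFA {
  qdim : nat;
  qinit : 'M[R[i]]_qdim;
  qop : Sigma -> 'M[R[i]]_qdim -> 'M[R[i]]_qdim;
  qacc : 'M[R[i]]_qdim;
  qinit_density : density qinit;
  qop_tp : forall s, tp_quantum_operation (qop s);
  qacc_projector : orthogonal_projector qacc
}.

Section InducedFunctions.
Variables (R : realType) (Sigma : finType).
Implicit Types (M : mo1gqfa R Sigma) (w : seq Sigma).

Definition run M w : 'M[R[i]]_(qdim M) :=
  foldl (fun rho s => qop s rho) (qinit M) w.

Definition accept_prob M w : R[i] := \tr (qacc M *m run M w).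

(* accept_prob is complex-valued by construction; accept_prob_ge0_le1 below
   shows that it is real and lies in [0, 1], hence so does any induced f. *)
Definition induced_by M (f : seq Sigma -> R) :=
  forall w, accept_prob M w = (f w)%:C.

Definition induced (f : seq Sigma -> R) :=
  exists M : mo1gqfa R Sigma, induced_by M f.

End InducedFunctions.

Section Range.
Variable R : realType.

Lemma adjmxM m n p (A : 'M[R[i]]_(m, n)) (B : 'M[R[i]]_(n, p)) :
  (A *m B)^t* = B^t* *m A^t*.
Proof. by rewrite trmx_mul map_mxM. Qed.

Lemma possemidef_conj n (K A : 'M[R[i]]_n) :
  possemidef A -> possemidef (K *m A *m K^t*).
Proof.
move=> A_ge0 v; have := A_ge0 (K^t* *m v).
by rewrite adjmxM trmxCK !mulmxA.
Qed.

Lemma possemidef_tr n (A : 'M[R[i]]_n) : possemidef A -> 0 <= \tr A.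
Proof.
move=> A_ge0; apply: sumr_ge0 => i _.
have := A_ge0 (delta_mx i 0); rewrite -mulmxA -colE trmx_delta map_delta_mx.
by rewrite -rowE !mxE.
Qed.

Lemma tp_quantum_operation_density n (Op : 'M[R[i]]_n -> 'M[R[i]]_n) rho :
  tp_quantum_operation Op -> density rho -> density (Op rho).
Proof.
move=> [m [K [K1 OpE]]] [rho_ge0 rho1]; split.
  move=> v; rewrite OpE mulmx_sumr mulmx_suml summxE.
  by apply: sumr_ge0 => k _; apply: possemidef_conj.
rewrite OpE raddf_sum /= -rho1 -[in RHS](mul1mx rho) -K1 mulmx_suml raddf_sum.
by apply: eq_bigr => k _ /=; rewrite mxtrace_mulC mulmxA.
Qed.

Lemma run_density (Sigma : finType) (M : mo1gqfa R Sigma) w :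
  density (run M w).
Proof.
rewrite /run; have := qinit_density M; move: (qinit M).
elim: w => [//|s w IHw] rho rhoD /=.
by apply/IHw/tp_quantum_operation_density => //; apply: qop_tp.
Qed.

Lemma projector_tr_ge0 n (P rho : 'M[R[i]]_n) :
  orthogonal_projector P -> possemidef rho -> 0 <= \tr (P *m rho).
Proof.
move=> [PP Padj] /(possemidef_conj P)/possemidef_tr.
by rewrite Padj mxtrace_mulC mulmxA PP.
Qed.

Lemma projector_compl n (P : 'M[R[i]]_n) :
  orthogonal_projector P -> orthogonal_projector (1%:M - P).
Proof.
move=> [PP Padj]; split.
  by rewrite mulmxBl mul1mx mulmxBr mulmx1 PP subrr subr0.
by rewrite linearB /= map_mxB Padj trmx1 map_mx1.
Qed.

Lemma accept_prob_ge0_le1 (Sigma : finType) (M : mo1gqfa R Sigma) w :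
  0 <= accept_prob M w <= 1.
Proof.
have [rho_ge0 rho1] := run_density M w; have Pacc := qacc_projector M.
rewrite projector_tr_ge0 //= -subr_ge0 -rho1 -linearB /=.
rewrite -[X in X - _]mul1mx -mulmxBl.
exact/projector_tr_ge0/rho_ge0/projector_compl.
Qed.

Lemma induced_ge0_le1 (Sigma : finType) (f : seq Sigma -> R) w :
  induced f -> 0 <= f w <= 1.
Proof.
by move=> [M Mf]; have := accept_prob_ge0_le1 M w; rewrite Mf !lecR.
Qed.

End Range.

(* Main.v *)
(** An automaton accepting with probability [1 - f] is obtained by complementing
    the accepting projector.  For convex combinations and products, induction
    on the number of functions reduces to two automata: a direct sum of the two
    with initial state [p rho1 (+) (1 - p) rho2] mixes the acceptance
    probabilities, and their tensor product multiplies them.  Positivity of the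
    tensor product of two states comes from a Gram factorization
    [A = B^* B] of positive semidefinite matrices, given by the spectral
    theorem. *)
Require Import Defs.
From mathcomp Require Import all_boot all_order all_algebra.
From mathcomp Require Import reals.
From mathcomp Require Import spectral complex mxtens boolp.

Set Implicit Arguments.
Unset Strict Implicit.
Unset Printing Implicit Defensive.

Import Order.TTheory GRing.Theory Num.Theory.

Local Open Scope ring_scope.
Local Open Scope complex_scope.
Local Open Scope sesquilinear_scope.

(** * Positive semidefinite matrices: self-adjointness and Gram factorization *)

Section PositiveSemidefinite.
Variable R : realType.
Local Notation C := R[i].

Lemma adjmx_quad m n (A : 'M[C]_(m, n)) (u : 'cV[C]_m) (v : 'cV[C]_n) :
  (v^t* *m A^t* *m u) 0 0 = ((u^t* *m A *m v) 0 0)^*%R.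
Proof.
transitivity ((u^t* *m A *m v)^t* 0 0); last by rewrite !mxE.
by rewrite !adjmxM trmxCK mulmxA.
Qed.

Lemma quad_eq0 n (B : 'M[C]_n) :
  (forall v : 'cV[C]_n, (v^t* *m B *m v) 0 0 = 0) -> B = 0.
Proof.
move=> B0.
pose e i : 'cV[C]_n := delta_mx i 0.
have entry i j : ((e i)^t* *m B *m e j) 0 0 = B i j.
  by rewrite trmx_delta map_delta_mx -rowE -colE !mxE.
have diag0 i : B i i = 0 by rewrite -entry B0.
apply/matrixP => i j; rewrite [RHS]mxE.
(* Polarization: evaluate the form at [e i + c *: e j] for [c = 1] and [c = 'i]. *)
have polar c : c * B i j + c^*%R * B j i = 0.
  have := B0 (e i + c *: e j).
  have -> : (e i + c *: e j)^t* = (e i)^t* + c^*%R *: (e j)^t*.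
    by rewrite linearD /= map_mxD linearZ /= map_mxZ.
  have addE (x y : 'M[C]_1) : (x + y) 0 0 = x 0 0 + y 0 0 by rewrite mxE.
  have scaleE a (x : 'M[C]_1) : (a *: x) 0 0 = a * x 0 0 by rewrite mxE.
  rewrite !mulmxDl !mulmxDr -!scalemxAl -!scalemxAr !(addE, scaleE) !entry.
  by rewrite !diag0 !mulr0 add0r addr0.
(* The case ['i] gives [B i j = B j i] and the case [1] gives [B i j + B j i = 0], so [B i j]
   doubled is zero. *)
have := polar 1; have := polar 'i.
rewrite conjCi conjC1 !mul1r mulNr -mulrBr.
move/eqP; rewrite mulf_eq0 (negbTE (neq0Ci _)) /= subr_eq0 => /eqP <-.
by move/eqP; rewrite -mulr2n mulrn_eq0 /= => /eqP.
Qed.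

(** [possemidef] does not ask for self-adjointness. It follows because the form is real-valued, so
    the form of [A^t* - A] vanishes identically. *)
Lemma possemidef_adj n (A : 'M[C]_n) : possemidef A -> A^t* = A.
Proof.
move=> A_ge0; apply/eqP; rewrite -subr_eq0; apply/eqP/quad_eq0 => v.
rewrite mulmxBr mulmxBl mxE adjmx_quad [X in _ + X]mxE.
by rewrite (CrealP (ger0_real (A_ge0 v))) subrr.
Qed.

Lemma gram_possemidef m n (B : 'M[C]_(m, n)) : possemidef (B^t* *m B).
Proof.
move=> v; rewrite -mulmxA -mulmxA mulmxA -adjmxM mxE.
by apply: sumr_ge0 => i _; rewrite !mxE mulrC mul_conjC_ge0.
Qed.

(** Being Hermitian, [A] is normal, hence equal to [P^t* D P] with [P] unitary and [D] diagonal. The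
    entries of [D] are nonnegative, so [B] can be [P] with its rows scaled by their square roots. *)
Lemma possemidef_gram n (A : 'M[C]_n) :
  possemidef A -> exists B : 'M[C]_n, A = B^t* *m B.
Proof.
move=> A_ge0.
have /hermitian_normalmx/orthomx_spectralP : A \is hermsymmx.
  by apply/is_hermitianmxP; rewrite expr0 scale1r possemidef_adj.
set P := spectralmx A; set d := spectral_diag A.
have PU : P \is unitarymx := spectral_unitarymx A.
rewrite invmx_unitary // => AE.
have d_ge0 i : 0 <= d 0 i.
  (* Column [i] of [P^t*] is a unit eigenvector for [d 0 i], so the form of [A] takes the value
     [d 0 i] there. *)
  have := A_ge0 (P^t* *m delta_mx i 0).
  rewrite {1}AE adjmxM trmxCK !mulmxA mulmxtVK // -!mulmxA (mulmxA P).
  rewrite (unitarymxP PU) mul1mx trmx_delta map_delta_mx -colE -rowE !mxE eqxx.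
  by rewrite mulr1n.
pose s := \row_i sqrtC (d 0 i).
exists (diag_mx s *m P).
rewrite adjmxM -mulmxA (mulmxA _ (diag_mx s)) {1}AE -!mulmxA; congr (_ *m _).
rewrite !mulmxA; congr (_ *m _).
rewrite tr_diag_mx map_diag_mx mulmx_diag; congr diag_mx.
apply/rowP => i; rewrite !mxE.
by rewrite [X in X * _]conj_Creal ?ger0_real ?sqrtC_ge0 // -expr2 sqrtCK.
Qed.

Lemma possemidefZ n (a : C) (A : 'M[C]_n) :
  0 <= a -> possemidef A -> possemidef (a *: A).
Proof.
by move=> a_ge0 A_ge0 v; rewrite -scalemxAr -scalemxAl mxE mulr_ge0.
Qed.

End PositiveSemidefinite.

(** * Direct sums of states, projectors and operations *)

Section DirectSum.
Variable R : realType.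
Local Notation C := R[i].

Definition dsummx m n p q (A : 'M[C]_(m, n)) (B : 'M[C]_(p, q)) :=
  block_mx A 0 0 B.

Lemma mul_dsummx m n p q r s (A : 'M[C]_(m, n)) (B : 'M[C]_(p, q))
    (A' : 'M[C]_(n, r)) (B' : 'M[C]_(q, s)) :
  dsummx A B *m dsummx A' B' = dsummx (A *m A') (B *m B').
Proof. by rewrite mulmx_block !mulmx0 !mul0mx !addr0 add0r. Qed.

Lemma adj_dsummx m n p q (A : 'M[C]_(m, n)) (B : 'M[C]_(p, q)) :
  (dsummx A B)^t* = dsummx (A^t*) (B^t*).
Proof. by rewrite tr_block_mx map_block_mx !trmx0 !map_mx0. Qed.

(** The off-diagonal blocks of the conjugate each contain both [A] and [B] as factors up to adjoint,
    so they vanish once one of the two is zero. *)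
Lemma conj_dsummx m n (A : 'M[C]_m) (B : 'M[C]_n) (rho : 'M[C]_(m + n)) :
  A = 0 \/ B = 0 ->
  dsummx A B *m rho *m (dsummx A B)^t* =
  dsummx (A *m ulsubmx rho *m A^t* ) (B *m drsubmx rho *m B^t* ).
Proof.
rewrite -{1}(submxK rho) adj_dsummx !/dsummx !mulmx_block => -[] ->;
  by rewrite !(trmx0, map_mx0, mul0mx, mulmx0, addr0, add0r).
Qed.

Lemma add_dsummx m n p q (A A' : 'M[C]_(m, n)) (B B' : 'M[C]_(p, q)) :
  dsummx A B + dsummx A' B' = dsummx (A + A') (B + B').
Proof. by rewrite add_block_mx !addr0. Qed.

Lemma dsummx_sum m n p q (I : finType) (A : I -> 'M[C]_(m, n))
    (B : I -> 'M[C]_(p, q)) :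
  \sum_i dsummx (A i) (B i) = dsummx (\sum_i A i) (\sum_i B i).
Proof.
elim/big_rec3: _ => [|i X Y Z _ ->]; first by rewrite /dsummx block_mx0.
by rewrite add_dsummx.
Qed.

Lemma possemidef_dsum m n (A : 'M[C]_m) (B : 'M[C]_n) :
  possemidef A -> possemidef B -> possemidef (dsummx A B).
Proof.
move=> A_ge0 B_ge0 v; rewrite -(vsubmxK v) tr_col_mx map_row_mx.
rewrite mul_row_block !mulmx0 addr0 add0r mul_row_col mxE.
exact: addr_ge0.
Qed.

Lemma density_dsum m n (p q : C) (A : 'M[C]_m) (B : 'M[C]_n) :
  0 <= p -> 0 <= q -> p + q = 1 ->
  density A -> density B -> density (dsummx (p *: A) (q *: B)).
Proof.
move=> p0 q0 pq [A0 A1] [B0 B1]; split.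
  by apply: possemidef_dsum; apply: possemidefZ.
by rewrite mxtrace_block !linearZ /= A1 B1 !mulr1.
Qed.

Lemma projector_dsum m n (P : 'M[C]_m) (Q : 'M[C]_n) :
  orthogonal_projector P -> orthogonal_projector Q ->
  orthogonal_projector (dsummx P Q).
Proof.
by move=> [PP Pa] [QQ Qa]; split; rewrite ?mul_dsummx ?adj_dsummx ?PP ?QQ ?Pa ?Qa.
Qed.

(** Coherences between the two summands are erased, so each automaton evolves on its own diagonal
    block. *)
Definition dsum_op m n (E : 'M[C]_m -> 'M[C]_m) (F : 'M[C]_n -> 'M[C]_n)
    (rho : 'M[C]_(m + n)) :=
  dsummx (E (ulsubmx rho)) (F (drsubmx rho)).

Lemma tp_dsum m n (E : 'M[C]_m -> 'M[C]_m) (F : 'M[C]_n -> 'M[C]_n) :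
  tp_quantum_operation E -> tp_quantum_operation F ->
  tp_quantum_operation (dsum_op E F).
Proof.
move=> [k [K [K1 EE]]] [l [L [L1 FE]]].
(* The Kraus family is the disjoint union of the two given ones, each operator padded by a zero
   block. The padding is what kills the off-diagonal blocks of [rho]. *)
exists (k + l)%N, (fun i => match split i with
  | inl a => dsummx (K a) 0 | inr b => dsummx 0 (L b) end).
have splitl (a : 'I_k) : split (lshift l a) = inl a := unsplitK (inl a).
have splitr (b : 'I_l) : split (rshift k b) = inr b := unsplitK (inr b).
split.
  rewrite big_split_ord /=.
  under eq_bigr do rewrite splitl adj_dsummx mul_dsummx mulmx0.
  under [X in _ + X]eq_bigr do rewrite splitr adj_dsummx mul_dsummx mulmx0.
  rewrite !dsummx_sum K1 L1 !big1_eq add_dsummx addr0 add0r.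
  by rewrite scalar_mx_block.
move=> rho; rewrite /dsum_op big_split_ord /= EE FE.
under [X in _ = X + _]eq_bigr do
  rewrite splitl (conj_dsummx _ (or_intror erefl)) !mul0mx.
under [X in _ = _ + X]eq_bigr do
  rewrite splitr (conj_dsummx _ (or_introl erefl)) !mul0mx.
by rewrite !dsummx_sum !big1_eq add_dsummx addr0 add0r.
Qed.

End DirectSum.

(** * Tensor products of states, projectors and operations *)

Section TensorProduct.
Variable R : realType.
Local Notation C := R[i].

Lemma adj_tensmx m n p q (A : 'M[C]_(m, n)) (B : 'M[C]_(p, q)) :
  (A *t B)^t* = A^t* *t B^t*.
Proof. by rewrite trmx_tens map_mxT. Qed.

Lemma mxtrace_tens m n (A : 'M[C]_m) (B : 'M[C]_n) :
  \tr (A *t B) = \tr A * \tr B.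
Proof. by rewrite mulr_sum; apply: eq_bigr => i _; rewrite mxE. Qed.

Lemma tensmx11 m n : (1%:M : 'M[C]_m) *t (1%:M : 'M[C]_n) = 1%:M.
Proof.
apply/matrixP => i j.
case: (mxtens_indexP i) => i0 i1; case: (mxtens_indexP j) => j0 j1.
rewrite tensmxE !mxE (can_eq (@mxtens_indexK _ _)) xpair_eqE.
by rewrite -natrM mulnb.
Qed.

Lemma tensmx_sum m n p q k l (A : 'I_k -> 'M[C]_(m, n))
    (B : 'I_l -> 'M[C]_(p, q)) :
  \sum_(i < k * l) A (mxtens_unindex i).1 *t B (mxtens_unindex i).2 =
  (\sum_i A i) *t (\sum_i B i).
Proof.
apply/matrixP => i j; rewrite mxE !summxE mulr_sum.
by apply: eq_bigr => h _; rewrite mxE.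
Qed.

(** The tensor product of the Gram matrices of [X] and [Y] is the Gram matrix of [X *t Y]. *)
Lemma possemidef_tens m n (A : 'M[C]_m) (B : 'M[C]_n) :
  possemidef A -> possemidef B -> possemidef (A *t B).
Proof.
move=> /possemidef_gram[X ->] /possemidef_gram[Y ->].
by rewrite -tensmx_mul -adj_tensmx; apply: gram_possemidef.
Qed.

Lemma density_tens m n (A : 'M[C]_m) (B : 'M[C]_n) :
  density A -> density B -> density (A *t B).
Proof.
move=> [A0 A1] [B0 B1]; split; first exact: possemidef_tens.
by rewrite mxtrace_tens A1 B1 mulr1.
Qed.

Lemma projector_tens m n (P : 'M[C]_m) (Q : 'M[C]_n) :
  orthogonal_projector P -> orthogonal_projector Q ->
  orthogonal_projector (P *t Q).
Proof.
by move=> [PP Pa] [QQ Qa]; split; rewrite ?tensmx_mul ?adj_tensmx ?PP ?QQ ?Pa ?Qa.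
Qed.

(** The Kraus operators of [G] are all products [K a *t L b]. Knowing [G] on pure tensors suffices
    later, because a product automaton started in a pure tensor stays in pure tensors. *)
Lemma tp_tens m n (E : 'M[C]_m -> 'M[C]_m) (F : 'M[C]_n -> 'M[C]_n) :
  tp_quantum_operation E -> tp_quantum_operation F ->
  exists2 G : 'M[C]_(m * n) -> 'M[C]_(m * n), tp_quantum_operation G
    & forall A B, G (A *t B) = E A *t F B.
Proof.
move=> [k [K [K1 EE]]] [l [L [L1 FE]]].
pose M (i : 'I_(k * l)) := K (mxtens_unindex i).1 *t L (mxtens_unindex i).2.
exists (fun rho => \sum_i M i *m rho *m (M i)^t*).
  exists (k * l)%N, M; split=> //; rewrite -tensmx11 -K1 -L1 -tensmx_sum.
  by apply: eq_bigr => i _; rewrite adj_tensmx tensmx_mul.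
move=> A B; rewrite EE FE -tensmx_sum.
by apply: eq_bigr => i _; rewrite adj_tensmx !tensmx_mul.
Qed.

End TensorProduct.

(** * Closure of the induced functions *)

Section Closure.
Variables (R : realType) (Sigma : finType).
Implicit Types f g : seq Sigma -> R.
Local Notation C := R[i].

(** Homogeneity carries the mixing weights of an initial state unchanged through a run. *)
Lemma tp_quantum_operationZ n (E : 'M[C]_n -> 'M[C]_n) a A :
  tp_quantum_operation E -> E (a *: A) = a *: E A.
Proof.
move=> [m [K [_ EE]]]; rewrite !EE scaler_sumr.
by apply: eq_bigr => k _; rewrite -scalemxAr -scalemxAl.
Qed.

Lemma eq_induced f g : f =1 g -> induced f -> induced g.
Proof. by move=> fg [M Mf]; exists M => w; rewrite Mf fg. Qed.

Lemma induced_compl f : induced f -> induced (fun w => 1 - f w).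
Proof.
move=> [M Mf].
pose N := MO1gQFA (qinit_density M) (@qop_tp _ _ M)
            (projector_compl (qacc_projector M)).
exists N => w; rewrite /accept_prob mulmxBl mul1mx linearB /= rmorphB rmorph1.
have [_ rho1] := run_density M w.
(* [N] differs from [M] only in its projector, so the two runs are convertible. *)
rewrite -[run N w]/(run M w) rho1.
by rewrite -[\tr _]/(accept_prob M w) Mf.
Qed.

Lemma induced_convex (p q : R) f g : 0 <= p -> 0 <= q -> p + q = 1 ->
  induced f -> induced g -> induced (fun w => p * f w + q * g w).
Proof.
move=> p0 q0 pq [M Mf] [N Ng].
have pC0 : 0 <= p%:C by rewrite lecR.
have qC0 : 0 <= q%:C by rewrite lecR.
have pqC : p%:C + q%:C = 1 by rewrite -rmorphD pq rmorph1.
pose D := MO1gQFA (density_dsum pC0 qC0 pqC (qinit_density M) (qinit_density N))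
  (fun s => tp_dsum (qop_tp M s) (qop_tp N s))
  (projector_dsum (qacc_projector M) (qacc_projector N)).
have runD w : run D w = dsummx (p%:C *: run M w) (q%:C *: run N w).
  rewrite /run /D /=; elim: w (qinit M) (qinit N) => [//|s w IHw] A B /=.
  rewrite -IHw /dsum_op block_mxKul block_mxKdr.
  by rewrite !tp_quantum_operationZ //; apply: qop_tp.
exists D => w; rewrite /accept_prob runD mul_dsummx mxtrace_block.
by rewrite -!scalemxAr !linearZ /= -/(accept_prob M w) -/(accept_prob N w)
  Mf Ng rmorphD !rmorphM.
Qed.

Lemma induced_mul f g : induced f -> induced g -> induced (fun w => f w * g w).
Proof.
move=> [M Mf] [N Ng].
(* The tensor operation is only known to exist letter by letter; choice turns this into a transition
   function. *)
have /choice[op opP] s : exists op : 'M[C]_(qdim M * qdim N) -> _,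
    tp_quantum_operation op /\
    forall A B, op (A *t B) = qop s A *t qop s B.
  by have [op ? ?] := tp_tens (qop_tp M s) (qop_tp N s); exists op.
pose T := MO1gQFA (density_tens (qinit_density M) (qinit_density N))
  (fun s => (opP s).1) (projector_tens (qacc_projector M) (qacc_projector N)).
have runT w : run T w = run M w *t run N w.
  rewrite /run /T /=; elim: w (qinit M) (qinit N) => [//|s w IHw] A B /=.
  by rewrite (opP s).2 IHw.
exists T => w; rewrite /accept_prob runT tensmx_mul mxtrace_tens.
by rewrite -/(accept_prob M w) -/(accept_prob N w) Mf Ng rmorphM.
Qed.

(** Serves as the empty product: a one-dimensional automaton that never moves and always accepts. *)
Lemma induced1 : induced (fun _ : seq Sigma => 1 : R).
Proof.
have D1 : density (1%:M : 'M[C]_1).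
  split; last by rewrite mxtrace1.
  by have := gram_possemidef (1%:M : 'M[C]_1); rewrite trmx1 map_mx1 mulmx1.
have id_tp (s : Sigma) : tp_quantum_operation (@id 'M[C]_1).
  exists 1%N, (fun=> 1%:M).
  by split=> [|rho]; rewrite big_ord1 trmx1 map_mx1 ?mul1mx ?mulmx1.
have P1 : orthogonal_projector (1%:M : 'M[C]_1).
  by split; rewrite ?mulmx1 ?trmx1 ?map_mx1.
exists (MO1gQFA D1 id_tp P1) => w.
rewrite /accept_prob /run /=.
have -> : foldl (fun rho _ => rho) 1%:M w = 1%:M :> 'M[C]_1 by elim: w.
by rewrite mulmx1 mxtrace1.
Qed.

(** The first function is mixed, with weight [c ord0], with the convex combination of the others,
    whose weights are renormalized by their total [S]. *)
Lemma induced_convex_sum (k : nat) (f : 'I_k -> seq Sigma -> R) (c : 'I_k -> R) :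
  (forall i, induced (f i)) -> (forall i, 0 < c i) -> \sum_(i < k) c i = 1 ->
  induced (fun w => \sum_(i < k) c i * f i w).
Proof.
elim: k f c => [|k IHk] f c find c_gt0.
  by rewrite big_ord0 => /esym/eqP; rewrite oner_eq0.
rewrite big_ord_recl; set S := \sum_(i < k) _ => c1.
(* With a single function [S] is zero and cannot be divided by; the only weight is then 1. *)
have [k0|k_gt0] := posnP k.
  apply: eq_induced (find ord0) => w; subst k.
  by move: c1; rewrite /S big_ord_recl !big_ord0 !addr0 => ->; rewrite mul1r.
have S_gt0 : 0 < S.
  rewrite /S (bigD1 (Ordinal k_gt0)) //= ltr_pwDl //.
  by apply: sumr_ge0 => i _; rewrite ltW.
have /= IH := IHk (f \o lift ord0) (fun i => c (lift ord0 i) / S)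
  (fun i => find _) (fun i => divr_gt0 (c_gt0 _) S_gt0).
rewrite -mulr_suml divff ?gt_eqF // in IH.
apply: eq_induced (induced_convex (ltW (c_gt0 ord0)) (ltW S_gt0) c1
  (find ord0) (IH erefl)) => w.
rewrite big_ord_recl mulr_sumr; congr (_ + _).
by apply: eq_bigr => i _; rewrite mulrA mulrCA divff ?gt_eqF // mulr1.
Qed.

Lemma induced_prod (k : nat) (f : 'I_k -> seq Sigma -> R) :
  (forall i, induced (f i)) -> induced (fun w => \prod_(i < k) f i w).
Proof.
elim: k f => [|k IHk] f find.
  by apply: eq_induced induced1 => w; rewrite big_ord0.
apply: eq_induced (induced_mul (find ord0) (IHk _ (fun i => find (lift ord0 i)))).
by move=> w; rewrite big_ord_recl.
Qed.

End Closure.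

Theorem theorem1 (R : realType) (Sigma : finType) :
  [/\ (forall f : seq Sigma -> R,
         induced f -> induced (fun w => 1 - f w)),
      (forall (k : nat) (f : 'I_k -> seq Sigma -> R) (c : 'I_k -> R),
         (forall i, induced (f i)) ->
         (forall i, 0 < c i) -> \sum_(i < k) c i = 1 ->
         induced (fun w => \sum_(i < k) c i * f i w))
    & (forall (k : nat) (f : 'I_k -> seq Sigma -> R),
         (0 < k)%N -> (forall i, induced (f i)) ->
         induced (fun w => \prod_(i < k) f i w))].
Proof.
split=> [f|k f c|k f _]; first exact: induced_compl.
  exact: induced_convex_sum.
exact: induced_prod.
Qed.
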